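(* Let $G$ be a finite group, and let $A$ be a finite free $G$-set with at least two elements. Then the finitary double centralizer clone $(\Sigma^A)^{\perp\perp(\aleph_0)}$ of $A$ is equal to the clone of finitary derived operations $\langle \Sigma^A\rangle_{\aleph_0}$ of $A$, where $\Sigma$ is the signature consisting of a unary operation symbol $\gamma$ for each $\gamma\in G$.
   Context: A free $G$-set is a set $A$ with an associative and unital left action $G\times A\to A$, $(\gamma,a)\mapsto\gamma a$, such that for all $\gamma\in G$ and $a\in A$, if $\gamma a=a$ then $\gamma=1$. $\Sigma^A$ denotes the set of basic unary operations $a\mapsto\gamma a$ on $A$ $(\gamma\in G)$. A finitary operation on a set $A$ is a map $A^n\to A$ with $n$ a finite cardinal ($n=0$ is allowed). A finitary clone on $A$ is a set $F$ of finitary operations on $A$ that contains all projections $\pi_i:A^n\to A$ and is such that for every $f:A^m\to A$ in $F$ and all $g_1,\dots,g_m:A^n\to A$ in $F$, the composite $f\circ(g_1,\dots,g_m):A^n\to A$ lies in $F$. The clone of finitary derived operations $\langle\Sigma^A\rangle_{\aleph_0}$ is the smallest finitary clone on $A$ containing $\Sigma^A$. Operations $f:A^n\to A$ and $g:A^m\to A$ commute, written $f\perp g$, if for every matrix $a=(a_{ij})\in A^{n\times m}$ one has $g\bigl((f((a_{ij})_{i\in n}))_{j\in m}\bigr)=f\bigl((g((a_{ij})_{j\in m}))_{i\in n}\bigr)$. For a set $F$ of finitary operations on $A$, $F^{\perp(\aleph_0)}$ is the set of all finitary operations $f$ on $A$ with $f\perp g$ for all $g\in F$, and $F^{\perp\perp(\aleph_0)}$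 is the result of applying $(-)^{\perp(\aleph_0)}$ twice to $F$. *)

(* Defs.v *)
From mathcomp Require Import all_boot all_fingroup all_algebra.

Set Implicit Arguments.
Unset Strict Implicit.
Unset Printing Implicit Defensive.

(* The carrier A is finite, so both A^n and the maps A^n -> A are taken as
   finite functions; Leibniz equality is then extensional equality. *)
Definition op (A : finType) (n : nat) := {ffun {ffun 'I_n -> A} -> A}.

Definition opset (A : finType) := forall n : nat, op A n -> Prop.

Definition opset_sub (A : finType) (F H : opset A) : Prop :=
  forall (n : nat) (f : op A n), F n f -> H n f.

Definition opset_eq (A : finType) (F H : opset A) : Prop :=
  forall (n : nat) (f : op A n), F n f <-> H n f.

Definition op_proj (A : finType) (n : nat) (i : 'I_n) : op A n :=
  [ffun x : {ffun 'I_n -> A} => x i].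

Definition op_comp (A : finType) (m n : nat) (f : op A m) (g : 'I_m -> op A n) :
    op A n :=
  [ffun x : {ffun 'I_n -> A} => f [ffun i => g i x]].

Definition is_clone (A : finType) (F : opset A) : Prop :=
  (forall (n : nat) (i : 'I_n), F n (op_proj A i)) /\
  (forall (m n : nat) (f : op A m) (g : 'I_m -> op A n),
     F m f -> (forall i, F n (g i)) -> F n (op_comp f g)).

Definition clone_gen (A : finType) (S : opset A) : opset A :=
  fun n f => forall F : opset A, is_clone F -> opset_sub S F -> F n f.

Definition commute_op (A : finType) (n m : nat) (f : op A n) (g : op A m) :
    Prop :=
  forall a : 'M[A]_(n, m),
    g [ffun j => f [ffun i => a i j]] = f [ffun i => g [ffun j => a i j]].

Definition centralizer (A : finType) (F : opset A) : opset A :=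
  fun n f => forall (m : nat) (g : op A m), F m g -> commute_op f g.

(* The library's {action _ &-> _} are right actions; G acts on the left here. *)
Definition is_left_action (G : finGroupType) (A : finType)
    (act : G -> A -> A) : Prop :=
  (forall a : A, act 1%g a = a) /\
  (forall (g h : G) (a : A), act (g * h)%g a = act g (act h a)).

Definition is_free_left_action (G : finGroupType) (A : finType)
    (act : G -> A -> A) : Prop :=
  is_left_action act /\ (forall (g : G) (a : A), act g a = a -> g = 1%g).

Definition act_op (G : finGroupType) (A : finType) (act : G -> A -> A)
    (g : G) : op A 1 :=
  [ffun x : {ffun 'I_1 -> A} => act g (x ord0)].

Inductive basic_ops (G : finGroupType) (A : finType) (act : G -> A -> A) :
    forall n : nat, op A n -> Prop :=
  BasicOp (g : G) : basic_ops act (act_op act g).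

(* Main.v *)
Require Import Defs.
From mathcomp Require Import all_boot all_fingroup all_algebra.

Set Implicit Arguments.
Unset Strict Implicit.
Unset Printing Implicit Defensive.

(** The centralizer of [Sigma^A] consists of the G-equivariant operations.  View
    an n-ary [f] as a point of the G-set [A^(A^n)], alongside the projections
    [pi_i]: if [f] commutes with every equivariant [g : A^(A^n) -> A], then
    [g f = f (g pi_1, ..., g pi_n)], so [g f] is determined by the [g pi_i].
    But [A^(A^n)] is free, so if [f] lay outside all the orbits [G pi_i], the
    value of [g] at [f] could be altered without changing any [g pi_i].  Hence
    [f = gamma pi_i] for some [gamma] and [i]. *)

Section Centralizers.

Variable A : finType.

(** Trades matrices for curried families, which can be instantiated and transposed directly. *)
Lemma commute_opP (n m : nat) (f : op A n) (g : op A m) :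
  commute_op f g <->
  (forall a : 'I_n -> 'I_m -> A,
     g [ffun j => f [ffun i => a i j]] = f [ffun i => g [ffun j => a i j]]).
Proof.
split=> [fg a|fg a]; last exact: fg (fun i j => a i j).
have := fg (\matrix_(i, j) a i j)%R.
have -> : [ffun j => f [ffun i => (\matrix_(i, j) a i j)%R i j]]
          = [ffun j => f [ffun i => a i j]].
  by apply/ffunP=> j; rewrite !ffunE; congr (f _); apply/ffunP=> i; rewrite !ffunE mxE.
move=> ->; congr (f _); apply/ffunP=> i; rewrite !ffunE; congr (g _).
by apply/ffunP=> j; rewrite !ffunE mxE.
Qed.

Lemma commute_op_sym (n m : nat) (f : op A n) (g : op A m) :
  commute_op f g -> commute_op g f.
Proof. by move=> /commute_opP fg a; rewrite (fg (fun i j => a j i)). Qed.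

(** For composites, [h] is moved first past [f], then past each [g k]. This makes the double
    centralizer a competitor in the minimality of [clone_gen]. *)
Lemma centralizer_is_clone (F : opset A) : is_clone (centralizer F).
Proof.
split=> [n i m g _ a|m n f g Ff Fg p h Fh a].
  by rewrite [RHS]ffunE ffunE; congr (g _); apply/ffunP=> j; rewrite !ffunE.
have /commute_opP fh := Ff p h Fh.
transitivity (h [ffun j => f [ffun k => g k [ffun i => a i j]]]).
  by congr (h _); apply/ffunP=> j; rewrite !ffunE.
rewrite fh ffunE; congr (f _); apply/ffunP=> k; rewrite !ffunE.
exact: Fg.
Qed.

Lemma bicentralizer_extensive (F : opset A) :
  opset_sub F (centralizer (centralizer F)).
Proof. by move=> n f Ff m g Fg; apply/commute_op_sym/Fg. Qed.

End Centralizers.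

Section FreeActions.

Variables (G : finGroupType) (A : finType) (act : G -> A -> A).

Definition equivariant (m : nat) (g : op A m) : Prop :=
  forall (h : G) (x : {ffun 'I_m -> A}), g [ffun i => act h (x i)] = act h (g x).

Lemma equivariant_centralizer (m : nat) (g : op A m) :
  equivariant g -> centralizer (@basic_ops G A act) g.
Proof.
move=> eqg _ _ [h] a; rewrite !ffunE -eqg; congr (g _).
by apply/ffunP=> i; rewrite !ffunE.
Qed.

Hypothesis hfree : is_free_left_action act.

Lemma act_inj (x : A) : injective (act^~ x).
Proof.
have [[act1 actM] free] := hfree => h k /= hk.
by apply/esym/eqP; rewrite eq_mulVg1; apply/eqP/(free _ x); rewrite actM hk -actM mulVg act1.
Qed.

Lemma act_cancel (h : G) : cancel (act h) (act h^-1%g).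
Proof. by have [[act1 actM] _] := hfree => x; rewrite -actM mulVg act1. Qed.

(** The [k]-th projection, altered only on the orbit of [y], where equivariance and the value [d] at
    [y] force [act h d]. *)
Definition modified_proj (m : nat) (k : 'I_m) (y : {ffun 'I_m -> A}) (d : A) :
    op A m :=
  [ffun x => if [pick h | x == [ffun i => act h (y i)]] is Some h
             then act h d else x k].

Section ModifiedProj.

Variables (m : nat) (k : 'I_m) (y : {ffun 'I_m -> A}) (d : A).

Lemma modified_proj_orbit (h : G) :
  modified_proj k y d [ffun i => act h (y i)] = act h d.
Proof.
(* Comparing coordinate [k] of the two multiples of [y], freeness shows that the picked [h'] is
   [h]. *)
rewrite ffunE; case: pickP => [h' /eqP/ffunP/(_ k)|/(_ h)]; last by rewrite eqxx.
by rewrite !ffunE => /act_inj ->.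
Qed.

Lemma modified_proj_out (x : {ffun 'I_m -> A}) :
  (forall h, x <> [ffun i => act h (y i)]) -> modified_proj k y d x = x k.
Proof. by move=> xy; rewrite ffunE; case: pickP => // h /eqP/xy. Qed.

Lemma modified_proj_equivariant : equivariant (modified_proj k y d).
Proof.
have [[act1 actM] _] := hfree => h x.
have [/existsP[h' /eqP->]|] := boolP [exists h', x == [ffun i => act h' (y i)]].
  rewrite modified_proj_orbit -actM -modified_proj_orbit; congr (modified_proj _ _ _ _).
  by apply/ffunP=> i; rewrite !ffunE actM.
rewrite negb_exists => /forallP xy.
have out h' : x <> [ffun i => act h' (y i)] by apply/eqP.
(* The complement of an orbit is stable under the action, so both values are given by the
   projection. *)
rewrite (modified_proj_out out) modified_proj_out ?ffunE // => h' /ffunP E.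
apply: (out (h^-1 * h')%g); apply/ffunP=> i.
by have := E i; rewrite !ffunE actM => <-; rewrite act_cancel.
Qed.

End ModifiedProj.

Lemma bicentralizer_basic_ops (hA : 1 < #|A|) (n : nat) (f : op A n) :
  centralizer (centralizer (@basic_ops G A act)) f ->
  exists (h : G) (i : 'I_n), f = [ffun x : {ffun 'I_n -> A} => act h (x i)].
Proof.
move=> Cf; have [[act1 actM] _] := hfree.
pose P (hi : G * 'I_n) := f == [ffun x : {ffun 'I_n -> A} => act hi.1 (x hi.2)].
have [/existsP[[h i] /eqP->]|] := boolP [exists hi, P hi]; first by exists h, i.
rewrite negb_exists => /forallP nP; exfalso.
have /card_gt1P[b [c [_ _ bc]]] := hA.
pose x0 : {ffun 'I_n -> A} := [ffun=> b].
have [d df] : exists d, d != f x0.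
  by have [<-|bf] := eqVneq b (f x0); [exists c; rewrite eq_sym | exists b].
(* [A^(A^n)] is encoded by enumerating [A^n]. *)
pose m := #|{ffun 'I_n -> A}|.
pose y : {ffun 'I_m -> A} := [ffun j => f (enum_val j)].
(* With this index, the unaltered projection is evaluation at [x0]. *)
pose k : 'I_m := enum_rank x0.
have Cg := equivariant_centralizer (modified_proj_equivariant k y d).
have /commute_opP/(_ (fun i j => (enum_val j : {ffun 'I_n -> A}) i)) := Cf _ _ Cg.
have -> : [ffun j : 'I_m => f [ffun i => (enum_val j : {ffun 'I_n -> A}) i]]
          = [ffun j => act 1%g (y j)].
  by apply/ffunP=> j; rewrite !ffunE act1; congr (f _); apply/ffunP=> i; rewrite ffunE.
(* Now [E] equates [d] with [f] at the values of the modified projection on the points [pi_i]; if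
   these are the [x0 i], then [d = f x0], a contradiction. *)
rewrite modified_proj_orbit act1 => E; case/eqP: df; rewrite E; congr (f _).
apply/ffunP=> i; rewrite ffunE modified_proj_out => [|h /ffunP Ei].
  by rewrite ffunE enum_rankK.
(* If [pi_i] were [h] times [f], then [f] would be [h^-1] times [pi_i], which [nP] excludes. *)
case/negP: (nP (h^-1%g, i)); apply/eqP/ffunP=> x.
by have := Ei (enum_rank x); rewrite !ffunE enum_rankK /= => ->; rewrite act_cancel.
Qed.

Lemma clone_gen_act_proj (n : nat) (h : G) (i : 'I_n) :
  clone_gen (@basic_ops G A act) [ffun x : {ffun 'I_n -> A} => act h (x i)].
Proof.
move=> F [Fproj Fcomp] subF.
have -> : [ffun x : {ffun 'I_n -> A} => act h (x i)]
          = op_comp (act_op act h) (fun _ => op_proj A i).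
  by apply/ffunP=> x; rewrite !ffunE.
by apply: Fcomp => [|_]; [apply: subF | apply: Fproj].
Qed.

End FreeActions.

Theorem theorem8p2 (G : finGroupType) (A : finType) (act : G -> A -> A)
    (hfree : is_free_left_action act) (hA : 1 < #|A|) :
  opset_eq (centralizer (centralizer (@basic_ops G A act)))
           (clone_gen (@basic_ops G A act)).
Proof.
move=> n f; split=> [/(bicentralizer_basic_ops hfree hA)[h [i ->]]|].
  exact: clone_gen_act_proj.
by apply; [apply: centralizer_is_clone | apply: bicentralizer_extensive].
Qed.
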